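(* Let $(X,\varrho)$ be a compact metric space, let $f:X\to X$ be continuous, and let $\bar f:\mathcal K(X)\to\mathcal K(X)$, $\bar f(A)=f(A)$, be the induced map on the hyperspace of nonempty compact subsets of $X$ with the Hausdorff metric. If $A\subset X$ is an attractor for $f$, then $\mathcal K(A)$ is an attractor for $\bar f$. Reciprocally, if $\mathcal A\subset\mathcal K(X)$ is an attractor for $\bar f$, then $\pi(\mathcal A)$ is an attractor for $f$.
   Context: For a continuous map $g:Y\to Y$ of a compact metric space $Y$, a closed subset $U\subset Y$ is a trapping region for $g$ if $\overline{g(U)}\subset U$. The attractor associated with a trapping region $U$ is $\omega(U,g)=\bigcap_{k}\overline{\bigcup_{n\ge k}g^n(U)}$, which equals $\bigcap_{n\ge1}g^n(U)$. A set is an attractor for $g$ if it is the attractor associated with some trapping region for $g$. For $A\subset X$, $\mathcal K(A)$ is the set of nonempty compact subsets of $X$ contained in $A$. For $\mathcal U\subset\mathcal K(X)$, the $X$-projection is $\pi(\mathcal U)=\{x\in X:\ \exists B\in\mathcal U\text{ with }x\in B\}$. $\mathcal K(X)$ carries the Hausdorff metric. *)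

(* Defs.v *)
From HB Require Import structures.
From mathcomp Require Import all_boot all_order all_algebra.
From mathcomp Require Import all_classical all_reals all_analysis.

Set Implicit Arguments.
Unset Strict Implicit.
Unset Printing Implicit Defensive.

Import Order.TTheory GRing.Theory Num.Theory.
Import numFieldNormedType.Exports.

Local Open Scope classical_set_scope.
Local Open Scope ring_scope.

Section attractors.
Context {Y : topologicalType}.
Implicit Types (g : Y -> Y) (U A : set Y).

Definition trapping_region g U := closed U /\ closure (g @` U) `<=` U.

Definition omega_set U g : set Y :=
  \bigcap_k closure (\bigcup_(n in [set n | (k <= n)%N]) (iter n g @` U)).

Definition attractor g A := exists2 U, trapping_region g U & A = omega_set U g.

End attractors.

Record hyperspace (X : topologicalType) : Type := Hyperspace {
  hcarrier :> set X ;
  hcompact : compact hcarrier ;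
  hnonempty : hcarrier !=set0
}.

Arguments hcompact {X} A : rename.
Arguments hnonempty {X} A : rename.

HB.instance Definition _ (X : topologicalType) := gen_eqMixin (hyperspace X).
HB.instance Definition _ (X : topologicalType) :=
  gen_choiceMixin (hyperspace X).

Section hyperspace.
Context {X : topologicalType}.

Lemma hyperspace_inj : injective (@hcarrier X).
Proof.
move=> [A cA A0] [B cB B0] /= AB; rewrite AB in cA A0 *.
by congr Hyperspace; exact: Prop_irrelevance.
Qed.

Definition induced_map (f : X -> X) (cf : continuous f) (A : hyperspace X) :
    hyperspace X :=
  Hyperspace (continuous_compact (continuous_subspaceT cf) (hcompact A))
    (image_nonempty f (hnonempty A)).

Definition compacts_in (A : set X) : set (hyperspace X) :=
  [set B : hyperspace X | B `<=` A].

Definition hyper_projection (U : set (hyperspace X)) : set X :=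
  [set x | exists2 B, U B & (B : set X) x].

End hyperspace.

Section hausdorff_distance.
Context {R : realType} {X : metricType R}.
Implicit Types (A B C : set X) (x y : X).

(* [inf] and [sup] are total on sets of reals; they are genuine extrema here as
   soon as the sets are nonempty and compact (see the lemmas below). *)
Definition dist_to_set x B : R := inf [set mdist x y | y in B].

Definition excess A B : R := sup [set dist_to_set x B | x in A].

Definition hausdorff_dist A B : R := Num.max (excess A B) (excess B A).

Let dist_has_lbound x B : has_lbound [set mdist x y | y in B].
Proof. by exists 0 => _ [y _ <-]; exact: mdist_ge0. Qed.

Lemma dist_to_set_le x y B : B y -> dist_to_set x B <= mdist x y.
Proof. by move=> By; apply: ge_inf => //; exists y. Qed.

Lemma dist_to_set_ge0 x B : B !=set0 -> 0 <= dist_to_set x B.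
Proof.
move=> [b Bb]; apply: lb_le_inf; first by exists (mdist x b), b.
by move=> _ [y _ <-]; exact: mdist_ge0.
Qed.

Lemma dist_to_set_adherent x B (e : R) : B !=set0 -> 0 < e ->
  exists2 y, B y & mdist x y < dist_to_set x B + e.
Proof.
move=> [b Bb] e0; have [||_ [y By <-] ?] :=
  @inf_adherent R [set mdist x y | y in B] e.
- by [].
- by split=> //; exists (mdist x b), b.
- by exists y.
Qed.

Lemma compact_mdist_bounded x A : compact A ->
  exists M : R, forall y, A y -> mdist x y <= M.
Proof.
move=> /compact_near_coveringP/(_ R +oo (fun M y => mdist x y <= M)) /= H.
have /H[] : forall y, A y -> \forall z \near y & M \near +oo, mdist x z <= M.
  move=> y Ay; exists (ball y 1, [set M | mdist x y + 1 <= M]) => /=.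
    by split; [exact: nbhsx_ballx|exact/nbhs_pinfty_ge/num_real].
  move=> [z M] /= [yz]; apply: le_trans.
  rewrite (le_trans (metric_triangle _ y _))// lerD2l ltW//.
  by move: yz; rewrite ballEmdist.
move=> M [_ HM]; exists (M + 1) => y Ay.
by apply: HM => //; rewrite ltrDl.
Qed.

Lemma dist_to_set_le_excess x A B : compact A -> B !=set0 -> A x ->
  dist_to_set x B <= excess A B.
Proof.
move=> cA [b Bb] Ax; apply: ub_le_sup; last by exists x.
have [M HM] := compact_mdist_bounded b cA.
exists M => _ [y Ay <-]; rewrite (le_trans (dist_to_set_le y Bb))//.
by rewrite metric_sym HM.
Qed.

Lemma excess_le A B (M : R) : A !=set0 ->
  (forall x, A x -> dist_to_set x B <= M) -> excess A B <= M.
Proof.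
move=> [a Aa] AM; apply: ge_sup; first by exists (dist_to_set a B), a.
by move=> _ [x Ax <-]; exact: AM.
Qed.

Lemma excess_ge0 A B : compact A -> A !=set0 -> B !=set0 -> 0 <= excess A B.
Proof.
move=> cA [a Aa] B0; rewrite (le_trans (dist_to_set_ge0 a B0))//.
exact: dist_to_set_le_excess.
Qed.

Lemma excessxx A : compact A -> A !=set0 -> excess A A = 0.
Proof.
move=> cA A0; apply/eqP; rewrite eq_le excess_ge0// andbT.
apply: excess_le => // x Ax.
by rewrite (le_trans (dist_to_set_le _ Ax))// mdistxx.
Qed.

Lemma excess_triangle A B C : compact A -> A !=set0 -> compact B -> B !=set0 ->
  C !=set0 -> excess A C <= excess A B + excess B C.
Proof.
move=> cA A0 cB B0 C0; apply: excess_le => // x Ax.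
apply/ler_addgt0Pl => e e0; have e2 : 0 < e / 2 by rewrite divr_gt0.
have [y By xy] := dist_to_set_adherent x B0 e2.
have [z Cz yz] := dist_to_set_adherent y C0 e2.
rewrite (le_trans (dist_to_set_le _ Cz))// (le_trans (metric_triangle _ y _))//.
rewrite [e]splitr addrACA lerD//.
  by rewrite (le_trans (ltW xy))// [leRHS]addrC lerD2r dist_to_set_le_excess.
by rewrite (le_trans (ltW yz))// [leRHS]addrC lerD2r dist_to_set_le_excess.
Qed.

Lemma excess0_subset A B : compact A -> compact B -> B !=set0 ->
  excess A B <= 0 -> A `<=` B.
Proof.
move=> cA cB B0 AB0 x Ax; have cB' := compact_closed (@metric_hausdorff _ X) cB.
apply: cB' => V /nbhs_ballP[e /= e0 eV].
have [y By xy] := dist_to_set_adherent x B0 e0.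
exists y; split=> //; apply: eV; rewrite ballEmdist/= (lt_le_trans xy)//.
by rewrite gerDr (le_trans _ AB0)// dist_to_set_le_excess.
Qed.

End hausdorff_distance.

Section hyperspace_metric.
Context {R : realType} {X : metricType R}.
Implicit Types A B C : hyperspace X.

Let hdist A B : R := hausdorff_dist A B.

Let hdistxx A : hdist A A = 0.
Proof.
by rewrite /hdist /hausdorff_dist maxxx excessxx//; [exact: hcompact|exact: hnonempty].
Qed.

Let hdist_positivity A B : hdist A B = 0 -> A = B.
Proof.
have [cA A0] := (hcompact A, hnonempty A); have [cB B0] := (hcompact B, hnonempty B).
move=> AB; apply: hyperspace_inj; have := lexx (hdist A B).
rewrite {2}AB /hdist /hausdorff_dist ge_max => /andP[? ?].
by apply/seteqP; split; exact: excess0_subset.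
Qed.

Let hdist_sym A B : hdist A B = hdist B A.
Proof. by rewrite /hdist /hausdorff_dist maxC. Qed.

Let hdist_triangle B A C : hdist A C <= hdist A B + hdist B C.
Proof.
have [cA A0] := (hcompact A, hnonempty A); have [cB B0] := (hcompact B, hnonempty B).
have [cC C0] := (hcompact C, hnonempty C).
rewrite /hdist /hausdorff_dist ge_max; apply/andP; split.
  by rewrite (le_trans (excess_triangle cA A0 cB B0 C0))// lerD// le_max lexx.
rewrite (le_trans (excess_triangle cC C0 cB B0 A0))// addrC.
by rewrite lerD// le_max lexx orbT.
Qed.

HB.instance Definition _ := @isMetric.Build R (hyperspace X)
  hdist hdistxx hdist_positivity hdist_sym hdist_triangle.

Lemma hyperspace_mdistE A B : mdist A B = hausdorff_dist A B.
Proof. by []. Qed.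

End hyperspace_metric.

(* Main.v *)
(* A trapping region [U] is forward invariant, so its attractor is the
   intersection of the closures of the decreasing sets [g^k(U)]. If [U] traps
   [A] for [f], then [K(U)] traps [K(A)] for the induced map, because a compact
   [B] contained in [f^k(U)] is the [k]-th image of the compact set of points of
   [U] sent into [B]. Conversely, if [V] is a trapping region in the hyperspace,
   its projection is one for [f]: compactness of the hyperspace makes
   projections of closed sets closed, and makes the projection commute with
   decreasing intersections of closed sets. *)
Require Import Defs.
From mathcomp Require Import all_boot all_order all_algebra.
From mathcomp Require Import all_classical all_reals all_analysis.

Set Implicit Arguments.
Unset Strict Implicit.
Unset Printing Implicit Defensive.

Import Order.TTheory GRing.Theory Num.Theory.

Local Open Scope classical_set_scope.

(** * Iterates on forward invariant sets *)

Lemma iter_image_subset (T : Type) (g : T -> T) (U : set T) (m n : nat) :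
  g @` U `<=` U -> (m <= n)%N -> iter n g @` U `<=` iter m g @` U.
Proof.
move=> gU mn _ [x Ux <-]; exists (iter (n - m) g x); last first.
  by rewrite -iterD subnKC.
by elim: (n - m)%N => [//|k IHk] /=; apply: gU; exists (iter k g x).
Qed.

Lemma omega_setE (Y : topologicalType) (g : Y -> Y) (U : set Y) :
  g @` U `<=` U -> omega_set U g = \bigcap_k closure (iter k g @` U).
Proof.
move=> gU; apply: eq_bigcapr => k _; congr closure.
apply/seteqP; split=> [x [n /= kn]|x Ux].
  exact: iter_image_subset.
by exists k => //=.
Qed.

Lemma trapping_region_sub (Y : topologicalType) (g : Y -> Y) (U : set Y) :
  trapping_region g U -> g @` U `<=` U.
Proof. by move=> [_ gU] x gx; apply: gU; exact: subset_closure. Qed.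

Lemma closed_forward_trapping (Y : topologicalType) (g : Y -> Y) (U : set Y) :
  closed U -> g @` U `<=` U -> trapping_region g U.
Proof.
move=> cU gU; split=> //; rewrite [X in _ `<=` X](closure_id U).1//.
exact: closureS.
Qed.

Lemma continuous_iter (Y : topologicalType) (g : Y -> Y) (n : nat) :
  continuous g -> continuous (iter n g).
Proof.
move=> cg; elim: n => [|n IHn] x /=; first exact: cvg_id.
by apply: continuous_comp; [exact: IHn|exact: cg].
Qed.

Lemma closed_iter_image (R : realType) (X : metricType R) (f : X -> X)
    (U : set X) (n : nat) :
  compact [set: X] -> continuous f -> closed U -> closed (iter n f @` U).
Proof.
move=> cX cf cU; apply: compact_closed; first exact: metric_hausdorff.
apply: continuous_compact; first exact/continuous_subspaceT/continuous_iter.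
exact: subclosed_compact cU cX _.
Qed.

Lemma iter_induced_map (X : topologicalType) (f : X -> X) (cf : continuous f)
    (n : nat) (B : hyperspace X) :
  iter n (induced_map cf) B = iter n f @` B :> set X.
Proof.
elim: n => [|n IHn] /=; first by rewrite image_id.
by rewrite IHn image_comp.
Qed.

Lemma hyper_projection_iter (X : topologicalType) (f : X -> X)
    (cf : continuous f) (n : nat) (V : set (hyperspace X)) :
  hyper_projection (iter n (induced_map cf) @` V) =
  iter n f @` (hyper_projection V).
Proof.
apply/seteqP; split=> [x [_ [B VB <-]]|_ [x [B VB Bx] <-]].
  by rewrite iter_induced_map => -[y By <-]; exists y => //; exists B.
exists (iter n (induced_map cf) B); first by exists B.
by rewrite iter_induced_map; exists x.
Qed.

(** * Compactness of the hyperspace and projections of closed families *)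

Section hyperspace_topology.
Context {R : realType} {X : metricType R}.
Implicit Types (A : set X) (B C : hyperspace X) (V : set (hyperspace X)).

Lemma hyperspace_mdist_lt B C x (e : R) : (mdist B C < e)%R -> (B : set X) x ->
  exists2 y, (C : set X) y & (mdist x y < e)%R.
Proof.
rewrite hyperspace_mdistE /hausdorff_dist gt_max => /andP[BCe _] Bx.
have xC : (dist_to_set x C < e)%R.
  apply: le_lt_trans BCe.
  by apply: dist_to_set_le_excess => //; [exact: hcompact|exact: hnonempty].
(* The strict bound leaves slack, so a near-minimiser in [C] is enough. *)
have e0 : (0 < e - dist_to_set x C)%R by rewrite subr_gt0.
have [y Cy xy] := dist_to_set_adherent x (hnonempty C) e0.
by exists y => //; rewrite addrC subrK in xy.
Qed.

Lemma closed_compacts_in A : closed A -> closed (compacts_in A).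
Proof.
move=> cA B clB x Bx; apply: cA => W /nbhs_ballP[e /= e0 eW].
have [C [CA]] := clB _ (nbhsx_ballx B e e0).
rewrite ballEmdist/= => /hyperspace_mdist_lt/(_ Bx)[y Cy xy].
by exists y; split; [exact: CA|apply: eW; rewrite ballEmdist].
Qed.

Lemma hyperspace_closed B : closed (B : set X).
Proof. by apply: compact_closed; [exact: metric_hausdorff|exact: hcompact]. Qed.

(** Membership is a closed relation between compacts and points. The joint neighbourhood in [C] and
    [y] is the shape that near-covering compactness consumes. *)
Lemma near_notin_hyperspace B x : ~ (B : set X) x ->
  \forall C \near B & y \near x, ~ hcarrier C y.
Proof.
move=> nBx; have : nbhs x (~` (B : set X)).
  by apply: open_nbhs_nbhs; split=> //; exact/closed_openC/hyperspace_closed.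
move=> /nbhs_ballP[e /= e0 eB].
have e2 : (0 < e / 2)%R by rewrite divr_gt0.
exists (ball B (e / 2)%R, ball x (e / 2)%R) => /=.
  by split; exact: nbhsx_ballx.
move=> [C y]/= [BC xy] Cy.
have [z Bz yz] : exists2 z, (B : set X) z & (mdist y z < e / 2)%R.
  apply: hyperspace_mdist_lt Cy.
  by move: BC; rewrite ballEmdist/= metric_sym.
apply: (eB z) => //; rewrite [e]splitr.
by apply: ball_triangle xy _; rewrite ballEmdist.
Qed.

(* The limit of an ultrafilter [F] is the set of points all of whose
   neighbourhoods meet [F]-almost all members of the hyperspace. *)
Lemma compact_hyperspace : compact [set: X] -> compact [set: hyperspace X].
Proof.
move=> cX; rewrite compact_ultra => F FU _.
pose L := [set x : X | forall e : R, (0 < e)%R ->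
  \forall B \near F, exists2 y, hcarrier B y & (mdist x y < e)%R].
(* Since [F] is an ultrafilter, failure at radius [e] means that [F]-almost all [B] miss the whole
   ball of radius [e] around [x]. *)
have nLP x : ~ L x -> \forall y \near x & B \near F, ~ hcarrier B y.
  move=> /existsNP[e /not_implyP[e0 nF]].
  pose M := [set B | exists2 y, hcarrier B y & (mdist x y < e)%R].
  have [//|FC] := in_ultra_setVsetC M FU.
  exists (ball x e, ~` M).
    by split=> //; exact: nbhsx_ballx.
  move=> [y B]/= [xy nB] By; apply: nB; exists y => //.
  by rewrite ballEmdist in xy.
have cvX := (compact_near_coveringP _).1 cX.
have Lc : closed L.
  move=> x clx; apply: contrapT => /nLP [[P Q] /= [xP FQ] PQ].
  have [y [Ly /nbhs_ballP[e /= e0 eP]]] := clx _ (nbhs_interior xP).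
  have [B [QB [z Bz yz]]] := filter_ex (filterI FQ (Ly e e0)).
  by apply: (PQ (z, B)) => //=; split=> //; apply: eP; rewrite ballEmdist.
have cL : compact L by exact: subclosed_compact Lc cX _.
have L0 : L !=set0.
  (* Were [L] empty, compactness of [X] would merge these local statements into a member [B] without
     points. *)
  apply: contrapT => L0.
  have /filter_ex[B nB] : \forall B \near F, [set: X] `<=` ~` hcarrier B.
    apply: cvX => x _; apply: nLP => Lx; apply: L0; by exists x.
  by have [b Bb] := hnonempty B; exact: (nB b).
exists (Hyperspace cL L0); split=> // W /nbhs_ballP[e /= e0 eW].
have e2 : (0 < e / 2)%R by rewrite divr_gt0.
have e4 : (0 < e / 2 / 2)%R by rewrite divr_gt0.
(* Near a point of [L] the distance to [L] is small; near any other point [F]-almost all [B] have no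
   points. Compactness of [X] makes this uniform. *)
have BL : \forall B \near F, [set: X] `<=`
    [set x | hcarrier B x -> (dist_to_set x L <= e / 2)%R].
  apply: cvX => x _; have [Lx|/nLP nLx] := pselect (L x); last first.
    by apply: filterS nLx => -[y B]/= nB /nB.
  exists (ball x (e / 2)%R, setT) => /=.
    by split; [exact: nbhsx_ballx|exact: filterT].
  move=> [y B]/= [xy _] _; apply: le_trans (dist_to_set_le y Lx) _.
  by rewrite metric_sym ltW//; rewrite ballEmdist in xy.
(* Half of [e / 2] pays for moving from [y] to the centre [x], half for reaching [B] from [x]. *)
have LB : \forall B \near F,
    L `<=` [set x | (dist_to_set x (hcarrier B) <= e / 2)%R].
  apply: ((compact_near_coveringP _).1 cL) => x Lx.
  exists (ball x (e / 2 / 2)%R,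
    [set B | exists2 y, hcarrier B y & (mdist x y < e / 2 / 2)%R]) => /=.
    by split; [exact: nbhsx_ballx|exact: Lx].
  move=> [y B]/= [xy [z Bz xz]]; apply: le_trans (dist_to_set_le y Bz) _.
  rewrite (le_trans (metric_triangle _ x _))// [leRHS]splitr.
  rewrite lerD//; last exact: ltW.
  by rewrite metric_sym ltW//; rewrite ballEmdist in xy.
apply: filterS (filterI BL LB) => B [/= BL' LB'].
apply: eW; rewrite ballEmdist/= hyperspace_mdistE /hausdorff_dist.
(* A supremum inherits only the weak bound [e / 2], hence this margin below [e]. *)
have e2e : (e / 2 < e)%R by rewrite gtr_pMr// invf_lt1// ltr1n.
rewrite gt_max; apply/andP.
split; apply: le_lt_trans e2e; apply: excess_le => //.
- exact: hnonempty.
- by move=> x Bx; exact: BL'.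
Qed.

Lemma closed_hyper_projection V :
  compact [set: X] -> closed V -> closed (hyper_projection V).
Proof.
move=> cX cV x clx; apply: contrapT => nx.
have cVc : compact V by exact: subclosed_compact cV (compact_hyperspace cX) _.
(* Compactness of [V] turns the neighbourhoods for single [B] into one neighbourhood of [x] missed
   by all members of [V]. *)
have : \forall y \near x, V `<=` [set B | ~ hcarrier B y].
  apply: ((compact_near_coveringP _).1 cVc) => B VB.
  by apply: near_notin_hyperspace => Bx; apply: nx; exists B.
move=> /clx[y [[B VB By] nB]]; exact: nB VB By.
Qed.

(** The member of [V k] through [x] may vary with [k]. If no [B] serves all [k], each [B] either
    misses [x], as do its neighbours, or lies outside some closed [V k], as do its neighbours from
    rank [k] on. Compactness then yields one rank at which no member contains [x]. *)
Lemma hyper_projection_bigcap (V : nat -> set (hyperspace X)) :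
  compact [set: X] -> (forall k, closed (V k)) ->
  (forall m n, (m <= n)%N -> V n `<=` V m) ->
  hyper_projection (\bigcap_k V k) = \bigcap_k hyper_projection (V k).
Proof.
move=> cX cV V_decr; apply/seteqP; split=> [x [B VB Bx] k _|x Vx].
  by exists B => //; exact: VB.
apply: contrapT => nx.
have /filter_ex[k nV] : \forall k \near \oo,
    [set: hyperspace X] `<=` [set B | V k B -> ~ hcarrier B x].
  apply: ((compact_near_coveringP _).1 (compact_hyperspace cX)) => B _.
  have [Bx|/near_notin_hyperspace [[P Q] /= [BP xQ] PQ]] :=
    pselect (hcarrier B x).
    have [k nVB] : exists k, ~ V k B.
      by apply/existsNP => VB; apply: nx; exists B => // k _; exact: VB.
    exists (~` V k, [set n | (k <= n)%N]) => /=.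
      split; last by exists k.
      by apply: open_nbhs_nbhs; split=> //; exact: closed_openC.
    by move=> [C n]/= [nVC kn] /(V_decr _ _ kn).
  exists (P, setT) => /=; first by split=> //; exact: filterT.
  move=> [C n]/= [PC _] _; apply: (PQ (C, x)); split=> //=.
  exact: nbhs_singleton.
by have [B VB Bx] := Vx k I; exact: nV VB Bx.
Qed.

End hyperspace_topology.

(** * Transfer of attractors between the two systems *)

Lemma compacts_in_iter_image (R : realType) (X : metricType R) (f : X -> X)
    (cf : continuous f) (U : set X) (n : nat) :
  compact [set: X] -> closed U ->
  iter n (induced_map cf) @` (compacts_in U) = compacts_in (iter n f @` U).
Proof.
move=> cX cU; apply/seteqP; split=> [_ [B BU <-] /=|B BU].
  by rewrite /compacts_in/= iter_induced_map; exact: image_subset.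
pose C := U `&` iter n f @^-1` B.
have cC : compact C.
  apply: subclosed_compact cX _ => //; apply: closedI => //.
  apply: preimage_closed; last exact: hyperspace_closed.
  by move=> x _; exact: continuous_iter.
have fC : iter n f @` C = B.
  apply/seteqP; split=> [_ [x [_ Bx] <-]//|x Bx].
  by have [y Uy yx] := BU _ Bx; exists y => //; split; rewrite // /preimage/= yx.
have C0 : C !=set0.
  have [b] := hnonempty B; rewrite -fC => -[c Cc _]; by exists c.
exists (Hyperspace cC C0); first by move=> x [].
by apply: hyperspace_inj; rewrite iter_induced_map.
Qed.

Theorem proposition2p4 (R : realType) (X : metricType R)
    (cX : compact [set: X]) (f : X -> X) (cf : continuous f) :
  (forall A : set X, attractor f A -> attractor (induced_map cf) (compacts_in A)) /\
  (forall A : set (hyperspace X),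
    attractor (induced_map cf) A -> attractor f (hyper_projection A)).
Proof.
split=> [_ [U trU ->]|_ [V trV ->]].
  have [cU _] := trU; have fU := trapping_region_sub trU.
  have FU : induced_map cf @` compacts_in U `<=` compacts_in U.
    move=> _ [B BU <-] _ [x Bx <-]; apply: fU; exists x => //; exact: BU.
  exists (compacts_in U).
    by apply: closed_forward_trapping => //; exact: closed_compacts_in.
  rewrite !omega_setE//; apply/seteqP; split=> B HB.
    move=> k _; apply: subset_closure; rewrite compacts_in_iter_image// => x Bx.
    rewrite [X in X x](closure_id _).1; first exact: HB.
    exact: closed_iter_image.
  move=> x Bx k _; apply: subset_closure; move: x Bx.
  have := HB k I; rewrite compacts_in_iter_image// -(closure_id _).1//.
  by apply: closed_compacts_in; exact: closed_iter_image.
have [cV _] := trV; have FV := trapping_region_sub trV.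
have cU := closed_hyper_projection cX cV.
have fU : f @` hyper_projection V `<=` hyper_projection V.
  move=> _ [x [B VB Bx] <-]; exists (induced_map cf B); last by exists x.
  by apply: FV; exists B.
exists (hyper_projection V); first exact: closed_forward_trapping.
rewrite !omega_setE// hyper_projection_bigcap//; last first.
- by move=> m n mn; exact: closureS (iter_image_subset FV mn).
- by move=> k; exact: closed_closure.
apply: eq_bigcapr => k _; have cfk := closed_iter_image (n := k) cX cf cU.
rewrite -((closure_id _).1 cfk); apply/seteqP; split.
  move=> x [B clB Bx].
  (* Members of the iterated image of [V] lie inside a closed subset of [X], and this containment
     survives Hausdorff limits. *)
  suff /(_ _ clB) : closure (iter k (induced_map cf) @` V) `<=`
      compacts_in (iter k f @` hyper_projection V) by exact.
  rewrite [X in _ `<=` X](closure_id _).1; last exact: closed_compacts_in.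
  apply: closureS => C VC y Cy; rewrite -(hyper_projection_iter cf).
  by exists C.
rewrite -(hyper_projection_iter cf) => x [B VB Bx]; exists B => //.
exact: subset_closure.
Qed.
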